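(* Fix $n$ and consider the service system with $n$ server pools described in the context. Consider any task assignment policy such that the occupancy process has a stationary distribution, and let $q_n$ be a random variable distributed as this stationary distribution. Then $$E\left[u(q_n)\right]\leq u\left(q_n^*\right),$$ where $u$ is the overall utility function and $q_n^*$ is the (fractional) task assignment defined in the context.
   Context: Let $\mathbb{N}=\{0,1,2,\dots\}$ and $m\geq 1$. For $i=1,\dots,m$ let $u_i:[0,\infty)\to\mathbb{R}$ be a concave function (only its values on $\mathbb{N}$ matter) and $\Delta(i,j)=u_i(j+1)-u_i(j)$ for $j\in\mathbb{N}$. Let $\mathcal{I}=\{1,\dots,m\}\times\mathbb{N}$ and $\mathcal{I}_+=\{(i,j)\in\mathcal{I}:j\geq 1\}$. Define a total order $\vartriangleleft$ on $\mathcal{I}_+$ by: $(i,j)\vartriangleleft(i',j')$ iff either $\Delta(i,j-1)<\Delta(i',j'-1)$, or $\Delta(i,j-1)=\Delta(i',j'-1)$ and $(i,j)$ is strictly larger than $(i',j')$ in the lexicographic order ($i>i'$, or $i=i'$ and $j>j'$). Write $\vartriangleright$ for the reverse order and $\trianglelefteq,\trianglerighteq$ for the non-strict versions. System. There are $n$ server pools, of which $A_n(i)\geq 1$ are of class $i\in\{1,\dots,m\}$; $\alpha_n(i)=A_n(i)/n$. Tasks arrive as a Poisson process of intensity $n\lambda$ and have i.i.d. service times with mean $1/\mu$ ($\lambda,\mu>0$, $\rho=\lambda/\mu$), independent of the arrivals. Each arriving task is immediately assigned to one server pool by the policy, and all tasks are executed in parallel, so that a task leaves after its service time irrespective of the policy.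 The occupancy state at a given time is $q=(q(i,j))_{(i,j)\in\mathcal{I}}$, where $q(i,j)$ is the number of server pools of class $i$ with at least $j$ tasks, divided by $n$; thus $0\le q(i,j+1)\le q(i,j)\le q(i,0)=\alpha_n(i)$. The policy is such that the evolution of the system can be described by a Markov process (with possibly uncountable state space) having a stationary distribution. Because of the infinite-server dynamics, under any policy the total number of tasks $n\sum_{(i,j)\in\mathcal{I}_+}q(i,j)$ is Poisson distributed with mean $n\rho$ in stationarity. The overall utility is $u(q)=\sum_{i=1}^m\sum_{j=0}^\infty u_i(j)\left[q(i,j)-q(i,j+1)\right]$ (possibly equal to $-\infty$). Let $\sigma_n^*$ be the unique element of $\mathcal{I}_+$ such that $\sum_{(i,j)\vartriangleright\sigma_n^*}\alpha_n(i)\leq\rho<\sum_{(i,j)\trianglerighteq\sigma_n^*}\alpha_n(i)$. Define $q_n^*(i,0)=\alpha_n(i)$ for all $i$ and, for $(i,j)\in\mathcal{I}_+$, $q_n^*(i,j)=0$ if $(i,j)\vartriangleleft\sigma_n^*$, $q_n^*(i,j)=\alpha_n(i)$ if $(i,j)\vartriangleright\sigma_n^*$, and $q_n^*(\sigma_n^* )=\rho-\sum_{(i,j)\vartriangleright\sigma_n^*}\alpha_n(i)$. *)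

(* Defs.v *)
From HB Require Import structures.
From mathcomp Require Import all_boot all_order all_algebra.
From mathcomp Require Import all_classical all_reals all_analysis.

Set Implicit Arguments.
Unset Strict Implicit.
Unset Printing Implicit Defensive.

Import Order.TTheory GRing.Theory Num.Theory.
Import numFieldNormedType.Exports.

Local Open Scope classical_set_scope.
Local Open Scope ring_scope.

Definition sigma_of {I Omega : Type} {d} {T : measurableType d}
    (D : set I) (Y : I -> Omega -> T) : set (set Omega) :=
  <<s \bigcup_(i in D) preimage_set_system setT (Y i) measurable >>.

Definition mutually_independent {R : realType} {d} {Omega : measurableType d}
    (P : probability Omega R) {I : choiceType} (F : I -> set (set Omega)) : Prop :=
  forall (J : seq I) (E : I -> set Omega), uniq J ->
    (forall i, i \in J -> F i (E i)) ->
    P (\bigcap_(i in [set` J]) E i) = (\prod_(i <- J) P (E i))%E.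

(* The event that exactly c of the times T k are in ]s, t]. *)
Definition arrivals_eq {R : realType} {Omega : Type} (T : nat -> Omega -> R)
    (s t : R) (c : nat) : set Omega :=
  [set w | ([set k | s < T k w <= t] #= `I_c)%card].

(* Increments are only considered over nondegenerate intervals because
   poisson_pmf 0 c = 1 for all c. *)
Definition poisson_process {R : realType} {d} {Omega : measurableType d}
    (P : probability Omega R) (r : R) (T : nat -> Omega -> R) : Prop :=
  [/\ forall k, measurable_fun setT (T k),
      forall k w, 0 < T k w < T k.+1 w,
      forall (s t : R) (c : nat), 0 <= s < t ->
        P (arrivals_eq T s t c) = (poisson_pmf (r * (t - s)) c)%:E &
      forall (N : nat) (t : nat -> R) (c : nat -> nat),
        0 <= t 0%N -> (forall i, t i < t i.+1) ->
        P (\bigcap_(i in `I_N) arrivals_eq T (t i) (t i.+1) (c i)) =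
        (\prod_(i < N) P (arrivals_eq T (t i) (t i.+1) (c i)))%E].

(* Independence of the family sigma(T), sigma(V 0), sigma(V 1), ... means that
   the V k are independent of each other and of the arrival times T. *)
Definition iid_service_times {R : realType} {d} {Omega : measurableType d}
    (P : probability Omega R) (mu : R) (T V : nat -> Omega -> R) : Prop :=
  [/\ forall k, measurable_fun setT (V k),
      forall k w, 0 <= V k w,
      forall k B, measurable B -> P (V k @^-1` B) = P (V 0%N @^-1` B),
      forall k, ('E_P[V k] = (mu^-1)%:E)%E &
      mutually_independent P (fun o : option nat =>
        if o is Some k then sigma_of [set k] V else sigma_of setT T)].

(* Time-homogeneous transition function, indexed by the times t >= 0. *)
Definition transition_function {R : realType} {d} {S : measurableType d}
    (K : R -> R.-pker S ~> S) : Prop :=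
  (forall x B, measurable B -> K 0 x B = \d_x B) /\
  (forall s t x B, 0 <= s -> 0 <= t -> measurable B ->
     K (s + t) x B = (\int[K s x]_y K t y B)%E).

Definition markov_process {R : realType} {d d'} {Omega : measurableType d}
    {S : measurableType d'} (P : probability Omega R)
    (K : R -> R.-pker S ~> S) (X : R -> Omega -> S) : Prop :=
  [/\ transition_function K,
      forall t, 0 <= t -> measurable_fun setT (X t) &
      forall s t (E : set Omega) (B : set S), 0 <= s -> 0 <= t ->
        sigma_of [set r | 0 <= r <= s] X E -> measurable B ->
        P (E `&` X (s + t) @^-1` B) = (\int[P]_(w in E) K t (X s w) B)%E].

Definition stationary_distribution {R : realType} {d} {S : measurableType d}
    (K : R -> R.-pker S ~> S) (pi : probability S R) : Prop :=
  forall t B, 0 <= t -> measurable B -> pi B = (\int[pi]_x K t x B)%E.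

(* The server pools are indexed by 'I_n and cls p is the class of pool p. *)
Definition pools_of_class {m n : nat} (cls : 'I_n -> 'I_m) (i : 'I_m) : nat :=
  #|[set p | cls p == i]%SET|.

Definition class_fraction (R : realType) {m n : nat} (cls : 'I_n -> 'I_m)
    (i : 'I_m) : R := (pools_of_class cls i)%:R / n%:R.

Definition occupancy (R : realType) {m n : nat} (cls : 'I_n -> 'I_m)
    (x : 'I_n -> nat) (i : 'I_m) (j : nat) : R :=
  #|[set p | (cls p == i) && (j <= x p)%N]%SET|%:R / n%:R.

(* The tasks at pool p at time t, when pool p holds x0 p tasks at time 0:
   - inl l, with l < x0 p, is the l-th of these initial tasks, which leaves at
     the (finite) time res p l;
   - inr k is the k-th task to arrive after time 0, which arrives at time T k,
     is assigned by the policy to pool a k and leaves at time T k + V k. *)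
Definition present {R : realType} {n : nat} (x0 : 'I_n -> nat)
    (res : 'I_n -> nat -> R) (T V : nat -> R) (a : nat -> 'I_n)
    (t : R) (p : 'I_n) : set (nat + nat) :=
  [set z | match z with
           | inl l => (l < x0 p)%N /\ t < res p l
           | inr k => a k = p /\ T k <= t < T k + V k
           end].

(* X is a process whose states determine, through tasks, the number of tasks
   at each of the pools, and these numbers evolve as in the service system with
   arrival times T, service times V and assignments a.  The assignments can
   depend on all the other random quantities, and the residual service times of
   the initial tasks can have an arbitrary law. *)
Definition system_evolution {R : realType} {d d'} {Omega : measurableType d}
    {S : measurableType d'} {n : nat} (tasks : S -> 'I_n -> nat)
    (T V : nat -> Omega -> R) (a : nat -> Omega -> 'I_n)
    (res : 'I_n -> nat -> Omega -> R) (X : R -> Omega -> S) : Prop :=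
  [/\ forall p, measurable_fun setT (fun x => tasks x p),
      forall k p, measurable [set w | a k w = p],
      forall p l, measurable_fun setT (res p l) &
      forall t w p, 0 <= t ->
        (present (tasks (X 0 w)) (fun p l => res p l w)
           (fun k => T k w) (fun k => V k w) (fun k => a k w) t p
         #= `I_(tasks (X t w) p))%card].

(* The random element q of 'I_m -> nat -> R (with the product sigma-algebra)
   has the law of f under pi. *)
Definition distributed_as {R : realType} {d d'} {Omega : measurableType d}
    {S : measurableType d'} {m : nat}
    (P : probability Omega R) (q : Omega -> 'I_m -> nat -> R)
    (pi : probability S R) (f : S -> 'I_m -> nat -> R) : Prop :=
  forall C : set ('I_m -> nat -> R),
    sigma_of setT (fun (ij : 'I_m * nat) (x : 'I_m -> nat -> R) =>
      x ij.1 ij.2) C ->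
    measurable (q @^-1` C) /\ P (q @^-1` C) = pi (f @^-1` C).

Definition concave_on_nonneg {R : realType} (f : R -> R) : Prop :=
  convex_function (E := R^o) [set x : R | 0 <= x] (fun x => - f x).

Definition utility {R : realType} {m : nat} (u : 'I_m -> R -> R)
    (q : 'I_m -> nat -> R) : \bar R :=
  (\sum_(i < m) \sum_(0 <= j <oo)
     (u i j%:R * (q i j - q i j.+1))%:E)%E.

Definition marginal {R : realType} {m : nat} (u : 'I_m -> R -> R)
    (i : 'I_m) (j : nat) : R := u i j.+1%:R - u i j%:R.

(* The strict order on the pairs (i, j) with j >= 1; pairs with j = 0 are never
   compared. *)
Definition below {R : realType} {m : nat} (u : 'I_m -> R -> R)
    (p q : 'I_m * nat) : bool :=
  (marginal u p.1 p.2.-1 < marginal u q.1 q.2.-1) ||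
  ((marginal u p.1 p.2.-1 == marginal u q.1 q.2.-1) &&
   ((q.1 < p.1)%N || ((p.1 == q.1) && (q.2 < p.2)%N))).

Definition mass_above {R : realType} {m : nat} (u : 'I_m -> R -> R)
    (alpha : 'I_m -> R) (s : 'I_m * nat) : \bar R :=
  \esum_(p in [set p | (1 <= p.2)%N /\ below u s p]) (alpha p.1)%:E.

Definition mass_above_eq {R : realType} {m : nat} (u : 'I_m -> R -> R)
    (alpha : 'I_m -> R) (s : 'I_m * nat) : \bar R :=
  \esum_(p in [set p | (1 <= p.2)%N /\ (p = s \/ below u s p)])
    (alpha p.1)%:E.

Definition is_sigma_star {R : realType} {m : nat} (u : 'I_m -> R -> R)
    (alpha : 'I_m -> R) (rho : R) (s : 'I_m * nat) : Prop :=
  [/\ (1 <= s.2)%N, (mass_above u alpha s <= rho%:E)%E &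
      (rho%:E < mass_above_eq u alpha s)%E].

Definition q_star {R : realType} {m : nat} (u : 'I_m -> R -> R)
    (alpha : 'I_m -> R) (rho : R) (s : 'I_m * nat) (i : 'I_m) (j : nat) : R :=
  if j == 0%N then alpha i
  else if below u (i, j) s then 0
  else if below u s (i, j) then alpha i
  else rho - fine (mass_above u alpha s).

(* Main.v *)
(** By Abel summation, u(q) is the constant sum_i u_i(0) alpha(i) plus the sum
    of Delta(i,j-1) q(i,j) over j >= 1.  Let D be the marginal utility at sigma.
    For any feasible q, (Delta(i,j-1) - D) (q(i,j) - q_star(i,j)) <= 0 termwise,
    because q_star saturates the pairs above sigma and vanishes below it; q_star
    adds up to rho over these pairs, so u(q) <= u(q_star) + D (sum q - rho).  As
    D may have any sign, it remains to see that sum q has mean exactly rho.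

    The number N_t of tasks at time t is the number A_t of
    present tasks among those that arrived in ]0, t], plus the number of initial
    tasks still present.  Cutting ]0, L h] into slots of length h and using that
    the k-th service time V is independent of the arrival times,
      r h sum_{1<=j<=L} P(V > j h) <= E A_{L h} <= r h sum_{0<=j<L} P(V > j h),
    where r is the arrival rate, while
      E V - h <= h sum_{j>=1} P(V > j h) <= E V.
    Stationarity and N_t >= A_t give E N >= r E V.  Conversely,
    min(N_t, M) <= A_t + M 1{some initial task is present}, and the probability
    of the last event vanishes as t grows, so E min(N, M) <= r E V for all M. *)

Require Import Defs.
From HB Require Import structures.
From mathcomp Require Import all_boot all_order all_algebra.
From mathcomp Require Import finmap.
From mathcomp Require Import all_classical all_reals all_analysis.
From mathcomp Require Import ring lra.
From mathcomp Require Import measurable_realfun.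

Set Implicit Arguments.
Unset Strict Implicit.
Unset Printing Implicit Defensive.

Import Order.TTheory GRing.Theory Num.Theory.
Import numFieldNormedType.Exports.

Local Open Scope classical_set_scope.
Local Open Scope ring_scope.

(** * Counting events *)

Lemma sum_poisson_pmf (R : realType) (r : R) : 0 < r ->
  (\sum_(c <oo) (poisson_pmf r c)%:E = 1)%E.
Proof.
move=> r0; rewrite nneseries_esumT; last first.
  by move=> c; rewrite lee_fin poisson_pmf_ge0.
by rewrite -[RHS](probability_setT (poisson_prob r 0)) /= /poisson_prob r0.
Qed.

(** The term at c = 0 vanishes and (c + 1) pmf(c + 1) = r pmf(c), so the shifted series is [r] times
    the total mass. *)
Lemma mean_poisson_pmf (R : realType) (r : R) : 0 < r ->
  (\sum_(c <oo) (c%:R * poisson_pmf r c)%:E = r%:E)%E.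
Proof.
move=> r0.
have pmf0 c : (0 <= (c%:R * poisson_pmf r c)%:E)%E.
  by rewrite lee_fin mulr_ge0// poisson_pmf_ge0.
rewrite nneseries_recl// mul0r add0e -nneseries_addn//.
transitivity (\sum_(c <oo) (r%:E * (poisson_pmf r c)%:E))%E.
  apply: eq_eseriesr => c _; rewrite -EFinM; congr EFin.
  rewrite addn1 /poisson_pmf r0 factS natrM exprS.
  have c1 : c.+1%:R != 0 :> R by rewrite pnatr_eq0.
  have cf : c`!%:R != 0 :> R by rewrite pnatr_eq0 -lt0n fact_gt0.
  by field; rewrite cf addrC natr1.
rewrite nneseriesZl ?sum_poisson_pmf ?mule1// => c _.
by rewrite lee_fin poisson_pmf_ge0.
Qed.

Lemma counting_card (R : realType) (T : choiceType) (D : set T) (c : nat) :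
  (D #= `I_c)%card -> counting D = c%:R%:E :> \bar R.
Proof.
move=> Dc; rewrite /counting asboolT; last by apply/finite_setP; exists c.
by rewrite (card_fset_set Dc).
Qed.

Lemma counting_eq_nat (R : realType) (T : choiceType) (D : set T) (c : nat) :
  (counting D = c%:R%:E :> \bar R) <-> (D #= `I_c)%card.
Proof.
split=> [|/counting_card//].
case: (pselect (finite_set D)) => [/finite_setP[k Dk]|Dinf].
  rewrite (counting_card _ Dk) => -[] /eqP; rewrite eqr_nat => /eqP <-.
  exact: Dk.
by rewrite /counting asboolF.
Qed.

Lemma counting_series (R : realType) (D : set nat) :
  counting D = (\sum_(k <oo) (\1_D k)%:E)%E :> \bar R.
Proof.
by rewrite counting_dirac; apply: eq_eseriesr => k _; rewrite diracE indicE.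
Qed.

Lemma counting_eventsE (R : realType) (Omega : Type) (E : nat -> set Omega) w :
  counting [set k | E k w] = (\sum_(k <oo) (\1_(E k) w)%:E)%E :> \bar R.
Proof. exact: counting_series. Qed.

Lemma measurable_nneseries (R : realType) d (Omega : measurableType d)
    (h : nat -> Omega -> \bar R) :
  (forall k w, 0 <= h k w)%E -> (forall k, measurable_fun setT (h k)) ->
  measurable_fun setT (fun w => \sum_(k <oo) h k w)%E.
Proof.
move=> h0 mh.
under eq_fun do rewrite (@eq_eseriesl _ _ (fun k => k \in predT))//.
by apply: ge0_emeasurable_sum => [k w _ _|k _].
Qed.

Lemma measurable_counting (R : realType) d (Omega : measurableType d)
    (E : nat -> set Omega) : (forall k, measurable (E k)) ->
  measurable_fun setT (fun w => counting [set k | E k w] : \bar R).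
Proof.
move=> mE; under eq_fun do rewrite counting_eventsE.
apply: measurable_nneseries => [k w|k]; first by rewrite lee_fin indicE.
by apply/measurable_EFinP; exact: measurable_indic.
Qed.

Lemma integral_counting (R : realType) d (Omega : measurableType d)
    (P : {measure set Omega -> \bar R}) (E : nat -> set Omega) :
  (forall k, measurable (E k)) ->
  (\int[P]_w counting [set k | E k w] = \sum_(k <oo) P (E k))%E.
Proof.
move=> mE; under eq_integral do rewrite counting_eventsE.
rewrite integral_nneseries//.
- by apply: eq_eseriesr => k _; rewrite integral_indic// setIT.
- by move=> k; apply/measurable_EFinP; exact: measurable_indic.
Qed.

(** Both sides are the mean of the number of events [E k] that occur. The events that this number is
    [c] have total mass one, so it is almost surely finite and its mean can be summed over [c]. *)
Lemma poisson_count_mean (R : realType) d (Omega : measurableType d)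
    (P : probability Omega R) (E : nat -> set Omega) (r : R) :
  0 < r -> (forall k, measurable (E k)) ->
  (forall c, P [set w | ([set k | E k w] #= `I_c)%card] =
             (poisson_pmf r c)%:E) ->
  (\sum_(k <oo) P (E k) = r%:E)%E.
Proof.
move=> r0 mE PE; rewrite -integral_counting//.
have mcnt := @measurable_counting R _ _ _ mE.
set cnt := fun w => counting [set k | E k w] : \bar R.
pose F c := [set w | ([set k | E k w] #= `I_c)%card].
have FE c : F c = cnt @^-1` [set c%:R%:E].
  by apply/seteqP; split=> w; rewrite /F /cnt /= counting_eq_nat.
have mF c : measurable (F c).
  by rewrite FE -[X in measurable X]setTI; apply: mcnt.
have PF c : P (F c) = (poisson_pmf r c)%:E by exact: PE.
have tF : trivIset setT F.
  move=> i j _ _ [w []]; rewrite !FE /= => -> [] /eqP.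
  by rewrite eqr_nat => /eqP.
pose D := \bigcup_c F c.
have mD : measurable D by exact: bigcupT_measurable.
have PD : P D = 1%E.
  rewrite /D measure_semi_bigcup// -(sum_poisson_pmf r0).
  by apply: eq_eseriesr => c _; exact: PF.
have PDC : P (~` D) = 0%E by rewrite probability_setC// PD subee.
have cnt0 w : (0 <= cnt w)%E by exact: measure_ge0.
rewrite -(setUv D) ge0_integral_setU//; last 3 first.
- exact: measurableC.
- by rewrite setUv.
- by apply/disj_setPS; rewrite setICr.
rewrite [X in (_ + X)%E]null_set_integral//; last 2 first.
- exact: measurableC.
- exact: measurable_funTS.
rewrite adde0 ge0_integral_bigcup//; last exact: measurable_funTS.
rewrite -[RHS](mean_poisson_pmf r0); apply: eq_eseriesr => c _.
rewrite (@eq_integral _ _ _ _ (F c) (cst c%:R%:E)).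
  rewrite integral_cst// EFinM; congr *%E; exact: PF.
by move=> w /set_mem; rewrite FE.
Qed.

Lemma mean_arrivals (R : realType) d (Omega : measurableType d)
    (P : probability Omega R) (r : R) (T : nat -> Omega -> R) (s t : R) :
  0 < r -> poisson_process P r T -> 0 <= s < t ->
  (\sum_(k <oo) P [set w | s < T k w <= t]%R = (r * (t - s))%:E)%E.
Proof.
move=> r0 [mT _ PT _] st; apply: poisson_count_mean.
- by rewrite mulr_gt0// subr_gt0; case/andP: st.
- move=> k; rewrite (_ : [set w | _] = T k @^-1` `]s, t]); last first.
    by apply/seteqP; split=> w /=; rewrite in_itv.
  by rewrite -[X in measurable X]setTI; apply: mT.
- by move=> c; exact: PT.
Qed.

(** Mutual independence is applied to the indices [None] and [Some k]. The common law of the service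
    times then makes the second factor the same for all [k]. *)
Lemma service_independence (R : realType) d (Omega : measurableType d)
    (P : probability Omega R) (mu : R) (T V : nat -> Omega -> R) (k : nat)
    (A B : set R) :
  iid_service_times P mu T V -> measurable A -> measurable B ->
  P (T k @^-1` A `&` V k @^-1` B) = (P (T k @^-1` A) * P (V 0%N @^-1` B))%E.
Proof.
move=> [_ _ PV _ ind] mA mB; rewrite -(PV k)//.
have := ind [:: None; Some k]
  (fun o => if o is Some k then V k @^-1` B else T k @^-1` A) isT.
rewrite !big_cons big_nil mule1 => <-.
  congr (P _); apply/seteqP; split=> [w [Tw Vw] o|w TVw].
    by rewrite /= !inE => /orP[] /eqP ->.
  by split; [apply: (TVw None)|apply: (TVw (Some k))];
    rewrite /= !inE eqxx ?orbT.
move=> o; rewrite !inE => /orP[] /eqP ->; apply: sub_sigma_algebra.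
  by exists k => //; exists A => //; rewrite setTI.
by exists k => //; exists B => //; rewrite setTI.
Qed.

(** * Arrivals that are still present *)

Definition task_present (R : realType) (Omega : Type) (T V : nat -> Omega -> R)
    (t : R) (k : nat) : set Omega := [set w | T k w <= t < T k w + V k w].

Lemma measurable_task_present (R : realType) d (Omega : measurableType d)
    (T V : nat -> Omega -> R) (t : R) (k : nat) :
  measurable_fun setT (T k) -> measurable_fun setT (V k) ->
  measurable (task_present T V t k).
Proof.
move=> mT mV.
have mTV : measurable_fun setT (T k \+ V k) by exact: measurable_funD.
rewrite (_ : task_present _ _ _ _ =
    T k @^-1` `]-oo, t] `&` (T k \+ V k) @^-1` `]t, +oo[).
  by apply: measurableI; rewrite -[X in measurable X]setTI;
    [apply: mT|apply: mTV].
apply/seteqP; split=> w; rewrite /task_present /= !in_itv /= andbT.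
  by move=> /andP.
by move=> [-> ->].
Qed.

Definition grid_arrival (R : realType) (Omega : Type) (T : nat -> Omega -> R)
    (h : R) (k i : nat) : set Omega :=
  [set w | i%:R * h < T k w <= i.+1%:R * h].

Lemma grid_arrivalE (R : realType) (Omega : Type) (T : nat -> Omega -> R)
    (h : R) (k i : nat) :
  grid_arrival T h k i = T k @^-1` `]i%:R * h, i.+1%:R * h].
Proof. by apply/seteqP; split=> w; rewrite /grid_arrival /= in_itv. Qed.

Lemma grid_cover (R : realType) (h x : R) (L : nat) : 0 < x <= L%:R * h ->
  exists2 i, (i < L)%N & i%:R * h < x <= i.+1%:R * h.
Proof.
elim: L => [|L IH] /andP[x0 xL]; first by move: xL; rewrite mul0r leNgt x0.
have [xLh|xLh] := leP x (L%:R * h).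
  by have [|i iL xi] := IH; [rewrite x0|exists i => //; exact: ltnW].
by exists L => //; rewrite xLh.
Qed.

Lemma trivIset_grid_arrival (R : realType) (Omega : Type)
    (T : nat -> Omega -> R) (h : R) (k : nat) : 0 <= h ->
  trivIset setT (grid_arrival T h k).
Proof.
move=> h0 i j _ _ [w [/andP[iT Ti] /andP[jT Tj]]].
have le_ij i1 j1 : i1%:R * h < T k w -> T k w <= j1.+1%:R * h -> (i1 <= j1)%N.
  move=> iT1 Tj1; rewrite leqNgt; apply/negP => ji.
  have := lt_le_trans iT1 Tj1; rewrite ltNge => /negP; apply.
  by rewrite ler_wpM2r// ler_nat.
by apply/eqP; rewrite eqn_leq !le_ij.
Qed.

Section arrivals_present.
Context (R : realType) d (Omega : measurableType d) (P : probability Omega R).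
Variables (r mu : R) (T V : nat -> Omega -> R).
Hypotheses (r0 : 0 < r) (arrivals : poisson_process P r T).
Hypothesis services : iid_service_times P mu T V.

Let tail (x : R) := P [set w | x < V 0%N w].

Let tailE x : tail x = P (V 0%N @^-1` `]x, +oo[).
Proof.
by congr (P _); apply/seteqP; split=> w; rewrite /= in_itv /= andbT.
Qed.

Let mT k : measurable_fun setT (T k). Proof. by case: arrivals. Qed.
Let mV k : measurable_fun setT (V k). Proof. by case: services. Qed.

Let mpre (f : Omega -> R) (B : set R) :
  measurable_fun setT f -> measurable B -> measurable (f @^-1` B).
Proof. by move=> mf mB; rewrite -[X in measurable X]setTI; exact: mf. Qed.

Let slot (h : R) k i x := grid_arrival T h k i `&` V k @^-1` `]x, +oo[.

Let mslot h k i x : measurable (slot h k i x).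
Proof. by apply: measurableI; rewrite ?grid_arrivalE; exact: mpre. Qed.

Let P_slot h k i x : P (slot h k i x) = (P (grid_arrival T h k i) * tail x)%E.
Proof.
by rewrite /slot tailE grid_arrivalE (service_independence _ services).
Qed.

(** Independence factors each term into the probability of an arrival in slot [i] and a tail; summed
    over [k], the former give the mean number [r * h] of arrivals in the slot. *)
Let sum_slot (h : R) L (x : nat -> R) : 0 < h ->
  (\sum_(k <oo) \sum_(i < L) P (slot h k i (x i)) =
   (r * h)%:E * \sum_(i < L) tail (x i))%E.
Proof.
move=> h0; rewrite nneseries_sum; last by move=> *; exact: measure_ge0.
rewrite ge0_sume_distrr; last by move=> *; exact: measure_ge0.
apply: eq_bigr => i _.
under eq_eseriesr do rewrite P_slot muleC.
have fin_tail : tail (x i) \is a fin_num.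
  by rewrite tailE; apply: fin_num_measure; exact: mpre.
rewrite -(fineK fin_tail) nneseriesZl; last by move=> *; exact: measure_ge0.
rewrite muleC; congr (_ * _)%E.
rewrite (_ : (r * h) = r * (i.+1%:R * h - i%:R * h)); last first.
  by rewrite -natr1; ring.
apply: mean_arrivals => //.
by rewrite ltr_pM2r// ltr_nat ltnSn andbT mulr_ge0// ltW.
Qed.

(** A task that arrived in slot [i] and is present at time L h has a service time above (L - i - 1)
    h. Reversing the order of the slots turns L - i - 1 into [j]. *)
Lemma mean_tasks_present_le (h : R) L : 0 < h ->
  (\sum_(k <oo) P (task_present T V (L%:R * h) k)
     <= (r * h)%:E * \sum_(j < L) tail (j%:R * h))%E.
Proof.
move=> h0; rewrite (reindex_inj rev_ord_inj) /=.
rewrite -(@sum_slot h L (fun i => (L - i.+1)%:R * h))//.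
apply: lee_nneseries => [*|k _]; first exact: measure_ge0.
apply: le_trans (@Boole_inequality _ _ _ P
  (fun i => slot h k i ((L - i.+1)%:R * h)) L (fun i _ => mslot h k i _)).
apply: le_measure; rewrite ?inE.
- exact: measurable_task_present.
- by apply: bigsetU_measurable => i _; exact: mslot.
rewrite -(@bigcup_mkord _ L (fun i => slot h k i ((L - i.+1)%:R * h))).
move=> w /andP[Tt tTV].
have T0 : 0 < T k w by case: arrivals => _ /(_ k w)/andP[].
have [|i iL /[dup] iT /andP[_ Ti]] := @grid_cover R h (T k w) L.
  by rewrite T0.
exists i => //; split=> //=; rewrite in_itv /= andbT.
rewrite natrB// mulrBl ltrBlDl; apply: (lt_le_trans tTV).
by rewrite lerD2r.
Qed.

(** A service time above (L - i) h keeps a task of slot [i] present at time L h. For fixed [k] these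
    events are disjoint in [i], so their probabilities add up. *)
Lemma mean_tasks_present_ge (h : R) L : 0 < h ->
  ((r * h)%:E * \sum_(j < L) tail (j.+1%:R * h)
     <= \sum_(k <oo) P (task_present T V (L%:R * h) k))%E.
Proof.
move=> h0; rewrite (reindex_inj rev_ord_inj) /=.
rewrite (eq_bigr (fun i : 'I_L => tail ((L - i)%:R * h))); last first.
  by move=> i _; rewrite -subSn.
rewrite -(@sum_slot h L (fun i => (L - i)%:R * h))//.
apply: lee_nneseries => [*|k _].
  by apply: sume_ge0 => *; exact: measure_ge0.
rewrite -(@measure_bigsetU _ _ _ P
  (fun i => slot h k i ((L - i)%:R * h))); last 2 first.
- by move=> i; exact: mslot.
- by move=> i j _ _ [w [[iT _] [jT _]]];
    apply: (trivIset_grid_arrival (ltW h0) I I);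
    exists w; split; [exact: iT|exact: jT].
apply: le_measure; rewrite ?inE.
- by apply: bigsetU_measurable => i _; exact: mslot.
- exact: measurable_task_present.
rewrite -(@bigcup_mkord _ L (fun i => slot h k i ((L - i)%:R * h))).
move=> w [i iL [/andP[iT Ti]]] /=.
rewrite in_itv /= andbT => tV; apply/andP; split.
  by apply: (le_trans Ti); rewrite ler_pM2r// ler_nat.
rewrite (_ : L%:R = i%:R + (L - i)%:R); last by rewrite -natrD subnKC// ltnW.
by rewrite mulrDl ltrD.
Qed.

End arrivals_present.

(** * Means as limits of tail sums on a grid *)

Lemma grid_floor_le (R : realType) (h v : R) (L : nat) : 0 < h -> 0 <= v ->
  \sum_(j < L) h * (j.+1%:R * h < v)%R%:R <= v.
Proof.
move=> h0 v0; elim: L => [|L IH]; first by rewrite big_ord0.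
rewrite big_ord_recr /=; case: ltP => [Lv|_]; last by rewrite mulr0 addr0.
rewrite mulr1 (le_trans _ (ltW Lv))// -natr1 mulrDl mul1r lerD2r.
rewrite mulr_natl -[X in _ *+ X]card_ord -sumr_const; apply: ler_sum => i _.
by case: ltP => _; rewrite ?mulr1 ?mulr0// ltW.
Qed.

(** The sum is [h] times the number of points below [v] among the first [L] positive grid points. It
    falls short of [v] by at most [h] unless all [L] points are below [v], which the minimum
    accounts for. *)
Lemma grid_floor_ge (R : realType) (h v : R) (L : nat) : 0 < h ->
  Num.min (v - h) (L%:R * h) <= \sum_(j < L) h * (j.+1%:R * h < v)%R%:R.
Proof.
move=> h0; elim: L => [|L IH]; first by rewrite big_ord0 mul0r ge_min lexx orbT.
rewrite big_ord_recr /=; case: ltP => [Lv|vL].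
  rewrite mulr1 ge_min -natr1 mulrDl mul1r lerD2r; apply/orP; right.
  apply: le_trans IH; rewrite le_min lexx andbT lerBrDr.
  by apply: le_trans (ltW Lv); rewrite -natr1 mulrDl mul1r.
rewrite mulr0 addr0; apply: le_trans IH.
rewrite ge_min le_min lexx /=; apply/orP; left.
by rewrite lerBlDr (le_trans vL)// -natr1 mulrDl mul1r.
Qed.

Section tail_sums.
Context (R : realType) d (Omega : measurableType d) (P : probability Omega R).
Variables (Y : Omega -> R) (h : R).
Hypotheses (mY : measurable_fun setT Y) (Y0 : forall w, 0 <= Y w) (h0 : 0 < h).

Let step (j : nat) (w : Omega) : \bar R := (h * (j.+1%:R * h < Y w)%R%:R)%:E.

Let mtail x : measurable [set w | x < Y w].
Proof.
rewrite (_ : [set w | _] = Y @^-1` `]x, +oo[).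
  by rewrite -[X in measurable X]setTI; exact: mY.
by apply/seteqP; split=> w; rewrite /= in_itv /= andbT.
Qed.

Let stepE j : step j =
  (fun w => h%:E * (\1_[set w | j.+1%:R * h < Y w] w)%:E)%E.
Proof.
apply/funext => w; rewrite /step EFinM indicE; congr (_ * (_%:R)%:E)%E.
by congr nat_of_bool; apply/idP/idP; rewrite inE.
Qed.

Let mstep j : measurable_fun setT (step j).
Proof.
rewrite stepE; apply: emeasurable_funM => //.
by apply/measurable_EFinP; exact: measurable_indic.
Qed.

Let step0 j w : (0 <= step j w)%E.
Proof. by rewrite lee_fin mulr_ge0// ltW. Qed.

Let integral_step j :
  (\int[P]_w step j w = h%:E * P [set w | j.+1%:R * h < Y w]%R)%E.
Proof.
rewrite stepE ge0_integralZl_EFin ?ltW//; last first.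
  by apply/measurable_EFinP; exact: measurable_indic.
by rewrite integral_indic// setIT.
Qed.

Let mYE : measurable_fun setT (fun w => (Y w)%:E).
Proof. exact/measurable_EFinP. Qed.

Lemma tail_sum_le L :
  (h%:E * \sum_(j < L) P [set w | j.+1%:R * h < Y w]%R <= 'E_P[Y])%E.
Proof.
rewrite ge0_sume_distrr; last by move=> *; exact: measure_ge0.
rewrite -(eq_bigr _ (fun j _ => integral_step _)) -ge0_integral_sum//.
rewrite expectation.unlock; apply: ge0_le_integral => //.
- by move=> w _; exact: sume_ge0.
- exact: emeasurable_sum.
by move=> w _; rewrite sumEFin lee_fin grid_floor_le.
Qed.

Lemma tail_sum_ge :
  ('E_P[Y] <= h%:E + h%:E * \sum_(j <oo) P [set w | j.+1%:R * h < Y w]%R)%E.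
Proof.
rewrite -nneseriesZl; last by move=> *; exact: measure_ge0.
rewrite -(eq_eseriesr (fun j _ => integral_step _)) -integral_nneseries//.
rewrite -[X in (X + _)%E](_ : \int[P]_w (cst h%:E w) = _)%E; last first.
  by rewrite integral_cst// -[RHS]mule1; congr *%E; exact: probability_setT.
have ms : measurable_fun setT (fun w => \sum_(j <oo) step j w)%E.
  exact: measurable_nneseries.
rewrite -ge0_integralD//; last 2 first.
- by move=> w _; rewrite lee_fin ltW.
- by move=> w _; exact: nneseries_ge0.
rewrite expectation.unlock; apply: ge0_le_integral => //.
- by move=> w _; rewrite lee_fin.
- exact: emeasurable_funD.
(* With this [L] the minimum in [grid_floor_ge] is [Y w - h]. *)
move=> w _; have [L YL] : exists L : nat, Y w - h <= L%:R * h.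
  exists (Num.truncn ((Y w - h) / h)).+1.
  by rewrite -ler_pdivrMr// ltW// truncnS_gt.
apply: le_trans (leeD (lexx _) (nneseries_lim_ge L _)) => //.
rewrite big_mkord sumEFin -EFinD lee_fin -lerBlDl.
by apply: le_trans (grid_floor_ge _ _ h0); rewrite le_min lexx.
Qed.

End tail_sums.

(** * Bounds on the mean number of present arrivals in terms of r / mu *)

Section mean_arrivals_present.
Context (R : realType) d (Omega : measurableType d) (P : probability Omega R).
Variables (r mu : R) (T V : nat -> Omega -> R).
Hypotheses (r0 : 0 < r) (arrivals : poisson_process P r T).
Hypothesis services : iid_service_times P mu T V.

Let mV : measurable_fun setT (V 0%N). Proof. by case: services. Qed.
Let V0 w : 0 <= V 0%N w. Proof. by case: services. Qed.
Let EV : ('E_P[V 0%N] = (mu^-1)%:E)%E. Proof. by case: services. Qed.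

(** The tail at zero, which [tail_sum_le] leaves out, is at most one and accounts for the error
    [r * h]. *)
Lemma mean_present_le (h : R) (L : nat) : 0 < h ->
  (\sum_(k <oo) P (task_present T V (L%:R * h) k) <= (r / mu + r * h)%:E)%E.
Proof.
move=> h0; apply: (le_trans (mean_tasks_present_le r0 arrivals services L h0)).
have tail0 x : (0 <= P [set w | x < V 0%N w]%R)%E by exact: measure_ge0.
apply: (@le_trans _ _
  ((r * h)%:E * (1 + \sum_(j < L) P [set w | j.+1%:R * h < V 0%N w]%R))%E).
  rewrite lee_pmul2l ?lte_fin ?mulr_gt0//.
  case: L => [|L]; first by rewrite !big_ord0 adde0.
  rewrite big_ord_recl; apply: leeD.
    apply: probability_le1.
    rewrite mul0r (_ : [set w | _] = V 0%N @^-1` `]0, +oo[).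
      by rewrite -[X in measurable X]setTI; exact: mV.
    by apply/seteqP; split=> w; rewrite /= in_itv /= andbT.
  by rewrite [leRHS]big_ord_recr /= leeDl.
rewrite ge0_muleDr ?sume_ge0// mule1 (addrC (r / mu)) EFinD leeD2l//.
rewrite !EFinM -muleA.
rewrite lee_pmul2l ?lte_fin//.
by rewrite -EV; exact: tail_sum_le.
Qed.

(** Letting [L] tend to infinity in [mean_tasks_present_ge] completes the tail sum. The bound [c] is
    extended because it will be a stationary mean that is not assumed to be finite. *)
Lemma mean_present_ge (h : R) (c : \bar R) : 0 < h ->
  (forall L : nat, \sum_(k <oo) P (task_present T V (L%:R * h) k) <= c)%E ->
  ((r / mu)%:E <= (r * h)%:E + c)%E.
Proof.
move=> h0 hc; have := tail_sum_ge P mV V0 h0; rewrite EV => EVh.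
have tail0 x : (0 <= P [set w | x < V 0%N w]%R)%E by exact: measure_ge0.
apply: (@le_trans _ _ (r%:E * (mu^-1)%:E)%E); first by rewrite -EFinM.
apply: (@le_trans _ _ (r%:E * (h%:E +
  h%:E * \sum_(j <oo) P [set w | j.+1%:R * h < V 0%N w]%R))%E).
  by rewrite lee_pmul2l ?lte_fin.
have hE0 : (0 <= h%:E)%E by rewrite lee_fin ltW.
have rhE0 : (0 <= (r * h)%:E)%E by rewrite lee_fin mulr_ge0 ?ltW.
rewrite ge0_muleDr//; last by rewrite mule_ge0// nneseries_ge0.
rewrite -EFinM leeD2l// muleA -EFinM -nneseriesZl//.
apply: lime_le => [|]; first by apply: is_cvg_nneseries => *; rewrite mule_ge0.
apply: nearW => L; rewrite big_mkord -ge0_sume_distrr//.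
exact: le_trans (mean_tasks_present_ge r0 arrivals services L h0) (hc L).
Qed.

End mean_arrivals_present.

(** * Mean number of tasks in stationarity *)

(** Both sides are integrals of [f] against the same image measure on [S]. The base spaces may
    differ, as they do for the process, its stationary law and the variable [q]. *)
Lemma ge0_integral_eq_law (R : realType) d1 d2 d3 (O1 : measurableType d1)
    (O2 : measurableType d2) (S : measurableType d3)
    (P1 : {measure set O1 -> \bar R}) (P2 : {measure set O2 -> \bar R})
    (X1 : O1 -> S) (X2 : O2 -> S) (f : S -> \bar R) :
  measurable_fun setT X1 -> measurable_fun setT X2 ->
  (forall B, measurable B -> P1 (X1 @^-1` B) = P2 (X2 @^-1` B)) ->
  measurable_fun setT f -> (forall x, 0 <= f x)%E ->
  (\int[P1]_w f (X1 w) = \int[P2]_w f (X2 w))%E.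
Proof.
move=> mX1 mX2 PX mf f0.
transitivity (\int[pushforward P1 X1]_x f x)%E.
  by rewrite ge0_integral_pushforward.
transitivity (\int[pushforward P2 X2]_x f x)%E.
  by apply: eq_measure_integral => A mA _; exact: PX.
by rewrite ge0_integral_pushforward.
Qed.

(** The Markov property from time 0, applied to the sure event, expresses the law of [X t] through
    that of [X 0], and stationarity reproduces [pi]. *)
Lemma stationary_law (R : realType) d d' (Omega : measurableType d)
    (S : measurableType d') (P : probability Omega R) (K : R -> R.-pker S ~> S)
    (X : R -> Omega -> S) (pi : probability S R) :
  markov_process P K X -> stationary_distribution K pi ->
  (forall B, measurable B -> P (X 0 @^-1` B) = pi B) ->
  forall t B, 0 <= t -> measurable B -> P (X t @^-1` B) = pi B.
Proof.
move=> [_ mX markov] stat X0 t B t0 mB.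
have sigmaT : sigma_of [set s : R | 0 <= s <= 0] X setT.
  apply: sub_sigma_algebra; exists 0; first by rewrite /= lexx.
  by exists setT => //; rewrite setTI preimage_setT.
have := markov 0 t setT B (lexx _) t0 sigmaT mB.
rewrite setTI add0r => ->; rewrite (stat t)//.
apply: (@ge0_integral_eq_law _ _ _ _ _ _ _ P pi (X 0) idfun
  (fun x => K t x B)) => //.
- exact: mX.
- exact: measurable_id.
- exact: measurable_kernel.
Qed.

Lemma counting_card_le (R : realType) (T : choiceType) (D : set T) (c : nat) :
  (D #<= `I_c)%card -> (counting D <= c%:R%:E :> \bar R)%E.
Proof.
move=> Dc; have /finite_setP[k Dk] : finite_set D.
  exact: (card_le_finite Dc (finite_II c)).
rewrite (counting_card _ Dk) lee_fin ler_nat -card_le_II.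
by rewrite -(card_le_eql Dk).
Qed.

Lemma counting_fibers (R : realType) (n : nat) (B : set nat) (a : nat -> 'I_n) :
  counting B = (\sum_(p < n) counting [set k | a k = p /\ B k])%E :> \bar R.
Proof.
under [RHS]eq_bigr do rewrite counting_series.
rewrite counting_series -nneseries_sum//; apply: eq_eseriesr => k _.
rewrite (bigD1 (a k))//= big1 ?adde0.
  rewrite !indicE; congr (_%:R%:E); congr nat_of_bool.
  by apply/idP/idP; rewrite !inE; [split|case].
by move=> p /eqP pa; rewrite indicE memNset//= => -[ap _]; apply: pa.
Qed.

Lemma measurable_fun_sumn d (S : measurableType d) (n : nat)
    (f : 'I_n -> S -> nat) : (forall p, measurable_fun setT (f p)) ->
  measurable_fun setT (fun x => \sum_(p < n) f p x)%N.
Proof.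
move=> mf; elim: (index_enum _) => [|p s IH].
  by under eq_fun do rewrite big_nil; exact: measurable_cst.
by under eq_fun do rewrite big_cons; apply: measurable_fun_addn.
Qed.

Section stationary_mean.
Context (R : realType) d d' (Omega : measurableType d) (S : measurableType d').
Variables (P : probability Omega R) (n : nat) (r mu : R).
Variables (T V : nat -> Omega -> R) (a : nat -> Omega -> 'I_n).
Variables (res : 'I_n -> nat -> Omega -> R) (tasks : S -> 'I_n -> nat).
Variables (X : R -> Omega -> S) (K : R -> R.-pker S ~> S).
Variable pi : probability S R.
Hypotheses (r0 : 0 < r) (arrivals : poisson_process P r T).
Hypothesis services : iid_service_times P mu T V.
Hypothesis evolution : system_evolution tasks T V a res X.
Hypothesis X_markov : markov_process P K X.
Hypothesis pi_stationary : stationary_distribution K pi.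
Hypothesis X0_pi : forall B, measurable B -> P (X 0 @^-1` B) = pi B.

Let N (x : S) : nat := (\sum_(p < n) tasks x p)%N.

Let mT k : measurable_fun setT (T k). Proof. by case: arrivals. Qed.
Let mV k : measurable_fun setT (V k). Proof. by case: services. Qed.
Let mX t : 0 <= t -> measurable_fun setT (X t).
Proof. by case: X_markov => _ mX _; exact: mX. Qed.

Let mtasks p : measurable_fun setT (fun x => tasks x p).
Proof. by case: evolution. Qed.

Let mN : measurable_fun setT N.
Proof. exact: measurable_fun_sumn. Qed.

Let mnat (f : nat -> \bar R) : measurable_fun setT (f \o N).
Proof. by apply: measurableT_comp mN. Qed.

Let mlt j : measurable [set x | (j < N x)%N].
Proof.
rewrite -[X in measurable X]setTI.
exact: (@mN measurableT [set c | (j < c)%N]).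
Qed.

Let law (f : nat -> \bar R) t : 0 <= t -> (forall c, 0 <= f c)%E ->
  (\int[P]_w f (N (X t w)) = \int[pi]_x f (N x))%E.
Proof.
move=> t0 f0.
apply: (@ge0_integral_eq_law _ _ _ _ _ _ _ P pi (X t) idfun (f \o N)) => //.
- exact: mX.
- exact: measurable_id.
- by move=> B mB; exact: stationary_law X_markov pi_stationary X0_pi t B t0 mB.
- by move=> x; exact: f0.
Qed.

Let A t w : \bar R := counting [set k | task_present T V t k w].

Let mtask t k : measurable (task_present T V t k).
Proof. exact: measurable_task_present. Qed.

Let int_A t : (\int[P]_w A t w = \sum_(k <oo) P (task_present T V t k))%E.
Proof. exact: integral_counting. Qed.

Let left_present t w p : 
  [set inr k | k in [set k | a k w = p /\ task_present T V t k w]] `<=`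
  present (tasks (X 0 w)) (fun p l => res p l w) (fun k => T k w)
    (fun k => V k w) (fun k => a k w) t p.
Proof. by move=> _ [k [kp kt] <-]. Qed.

(** Pool by pool, [inr] embeds the surviving arrivals into the set of present tasks. *)
Let A_le t w : 0 <= t -> (A t w <= (N (X t w))%:R%:E)%E.
Proof.
move=> t0; rewrite /A (counting_fibers _ _ (fun k => a k w)).
rewrite /N natr_sum -sumEFin.
apply: lee_sum => p _; apply: counting_card_le.
have [_ _ _ /(_ t w p t0) tp] := evolution.
rewrite -(card_le_eqr tp).
apply: card_le_trans (subset_card_le (@left_present t w p)).
by rewrite (card_le_eqr (inj_card_eq _))// => x y _ _ [].
Qed.

(** The residual times have an arbitrary law, so what gets controlled is the event that some initial
    task survives, rather than the mean number of survivors. *)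
Let initial_present t : set Omega :=
  \bigcup_(pl in [set: 'I_n * nat])
    [set w | (pl.2 < tasks (X 0 w) pl.1)%N /\ t < res pl.1 pl.2 w].

Let N_eq t w : 0 <= t -> ~ initial_present t w -> A t w = (N (X t w))%:R%:E.
Proof.
move=> t0 noinit; rewrite /A (counting_fibers _ _ (fun k => a k w)).
rewrite /N natr_sum -sumEFin.
apply: eq_bigr => p _; apply: counting_card.
have [_ _ _ /(_ t w p t0) tp] := evolution.
rewrite -(card_eqr tp).
rewrite -(card_eql (inj_card_eq (f := inr : nat -> nat + nat) _)); last first.
  by move=> x y _ _ [].
rewrite (_ : _ @` _ = present (tasks (X 0 w)) (fun p l => res p l w)
    (fun k => T k w) (fun k => V k w) (fun k => a k w) t p).
  exact: card_eqxx.
apply/seteqP; split=> [|[l|k]]; first exact: left_present.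
  by move=> [lp tl]; exfalso; apply: noinit; exists (p, l).
by move=> [kp kt]; exists k.
Qed.

Let minit t : measurable (initial_present t).
Proof.
have [_ _ mres _] := evolution.
apply: countable_bigcupT_measurable => [|[p l]]; first exact: countableP.
apply: measurableI.
  rewrite -[X in measurable X]setTI.
  have mt0 : measurable_fun setT ((fun x => tasks x p) \o X 0).
    by apply: measurableT_comp => //; exact: mX.
  exact: (mt0 measurableT [set c | (l < c)%N]).
rewrite [X in measurable X](_ : _ = res p l @^-1` `]t, +oo[).
  by rewrite -[X in measurable X]setTI; exact: mres.
by apply/seteqP; split=> w; rewrite /= in_itv /= andbT.
Qed.

(** In each outcome the initial tasks are finitely many and have finite residual times, so these
    decreasing events have empty intersection and continuity from above applies. *)
Let P_init (h : R) : 0 < h ->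
  (P (initial_present (L%:R * h)%R) @[L --> \oo] --> 0)%E.
Proof.
move=> h0; pose F L := initial_present (L%:R * h).
have FE : \bigcap_L F L = set0.
  rewrite -subset0 => w Fw.
  (* This sum bounds the residual time of every initial task. *)
  pose M := \sum_(p < n) \sum_(l < tasks (X 0 w) p) `|res p l w|.
  have [[p l] _ /= [lp]] := Fw (Num.truncn (M / h)).+1 I.
  apply/negP; rewrite -leNgt -ler_pdivrMr//.
  apply: le_trans (ltW (truncnS_gt _)).
  rewrite ler_pM2r ?invr_gt0// /M (bigD1 p)//= (bigD1 (Ordinal lp))//= -addrA.
  rewrite (le_trans (ler_norm _))// lerDl addr_ge0 ?sumr_ge0// => i _.
  by rewrite sumr_ge0.
rewrite -(measure0 P) -FE; apply: nonincreasing_cvg_mu.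
- by rewrite -ge0_fin_numE ?fin_num_measure.
- by move=> L; exact: minit.
- by rewrite FE.
move=> i j ij; apply/subsetPset => w [pl _ [lp jr]]; exists pl => //; split=> //.
by apply: le_lt_trans jr; rewrite ler_wpM2r ?ler_nat// ltW.
Qed.

(** The left side is the mean of min(N, M). Truncation limits the effect of surviving initial tasks
    to [M] times a vanishing probability. *)
Let truncated_le (h : R) (M : nat) : 0 < h ->
  (\sum_(0 <= j < M) pi [set x | (j < N x)%N] <= (r / mu + r * h)%:E)%E.
Proof.
(* [f c] is min(c, M), written as a sum of indicators. *)
move=> h0; pose f c : \bar R := (\sum_(0 <= j < M) (\1_(`I_c) j)%:E)%E.
have f0 c : (0 <= f c)%E by apply: sume_ge0 => j _; rewrite lee_fin indicE.
have -> : (\sum_(0 <= j < M) pi [set x | (j < N x)%N] = \int[pi]_x f (N x))%E.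
  rewrite /f ge0_integral_sum//; last first.
    by move=> j; apply: (mnat (fun c => (\1_(`I_c) j)%:E)).
  by apply: eq_bigr => j _; rewrite -[in LHS](setIT [set x | _]) -integral_indic.
(* By stationarity the left side is the same at all times [L%:R * h], so [L] may tend to infinity on
   the right. *)
have bound L : (\int[pi]_x f (N x) <=
    (r / mu + r * h)%:E + M%:R%:E * P (initial_present (L%:R * h)%R))%E.
  have t0 : 0 <= L%:R * h by rewrite mulr_ge0// ltW.
  rewrite -(law t0)//.
  have mA : measurable_fun setT (A (L%:R * h)) by exact: measurable_counting.
  have A0 w : (0 <= A (L%:R * h) w)%E by exact: measure_ge0.
  have mU : measurable_fun setT
      (fun w => (\1_(initial_present (L%:R * h)) w)%:E : \bar R).
    by apply/measurable_EFinP; exact: measurable_indic.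
  have U0 w : (0 <= M%:R%:E * (\1_(initial_present (L%:R * h)%R) w)%:E)%E.
    by rewrite mule_ge0// lee_fin.
  apply: (@le_trans _ _ (\int[P]_w (A (L%:R * h)%R w +
      M%:R%:E * (\1_(initial_present (L%:R * h)%R) w)%:E))%E).
    apply: ge0_le_integral => //.
    - apply: (@measurableT_comp _ _ _ _ _ _ (f \o N)); first exact: mnat.
      exact: mX.
    - by apply: emeasurable_funD => //; exact: emeasurable_funM.
    move=> w _; rewrite indicE.
    (* If an initial task survives, [f] is at most [M]; otherwise the number of tasks is [A] and
       bounds its own truncation. *)
    case: (boolP (w \in _)) => [_|/negP wU].
      rewrite mule1 -[leLHS]add0e; apply: leeD => //.
      apply: (@le_trans _ _ (\sum_(0 <= j < M) 1)%E).
        by apply: lee_sum => j _; rewrite lee_fin indicE lern1 leq_b1.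
      by rewrite sumEFin lee_fin sumr_const_nat subn0.
    rewrite mule0 adde0 N_eq//; last by move=> wU'; apply: wU; rewrite inE.
    rewrite -(counting_card R (card_eqxx `I_(N (X (L%:R * h) w)))).
    rewrite counting_series.
    by apply: nneseries_lim_ge => *; rewrite lee_fin indicE.
  rewrite ge0_integralD//; last exact: emeasurable_funM.
  rewrite ge0_integralZl_EFin// integral_indic// setIT int_A leeD2r//.
  exact: mean_present_le.
have cvgM : ((r / mu + r * h)%:E + M%:R%:E * P (initial_present (L%:R * h)%R)
    @[L --> \oo] --> (r / mu + r * h)%:E + M%:R%:E * 0)%E.
  apply: cvgeD; first by rewrite fin_num_adde_defr.
    exact: cvg_cst.
  by apply: cvgeZl => //; exact: P_init.
rewrite mule0 adde0 in cvgM; rewrite -(cvg_lim _ cvgM)//.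
by apply: lime_ge; [apply/cvg_ex; eexists; exact: cvgM|exact: nearW].
Qed.

Lemma stationary_mean : (\int[pi]_x (N x)%:R%:E = (r / mu)%:E)%E.
Proof.
apply/eqP; rewrite eq_le; apply/andP; split; apply/lee_addgt0Pr => e e0.
(* The slot length [e / r] turns the error [r * h] into [e]. *)
all: have h0 : 0 < e / r by rewrite divr_gt0.
all: have rh : r * (e / r) = e by rewrite mulrC divfK// gt_eqF.
- rewrite -EFinD -{}rh.
  (* The mean of [N] becomes the sum of its tails, whose partial sums are bounded by
     [truncated_le]. *)
  under eq_integral => x _.
    rewrite -(counting_card R (card_eqxx `I_(N x))).
    over.
  rewrite (integral_counting pi mlt).
  apply: lime_le; first by apply: is_cvg_nneseries => *; exact: measure_ge0.
  by apply: nearW => M; exact: truncated_le.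
rewrite addeC -{}rh; apply: (mean_present_ge r0 arrivals services h0) => L.
have t0 : 0 <= L%:R * (e / r) by rewrite mulr_ge0// ltW.
rewrite -int_A -(law t0 (f := fun c => c%:R%:E))//.
apply: ge0_le_integral => //.
- exact: measurable_counting.
- apply: (@measurableT_comp _ _ _ _ _ _ (fun x => (N x)%:R%:E)); last exact: mX.
  exact: (mnat (fun c => c%:R%:E)).
- by move=> w _; exact: A_le.
Qed.

End stationary_mean.

(** * Optimal fractional assignment *)

Lemma abel_sum (R : realType) (v q : nat -> R) (J : nat) :
  \sum_(0 <= j < J) v j * (q j - q j.+1) =
  v 0%N * q 0%N + \sum_(0 <= j < J) (v j.+1 - v j) * q j.+1 - v J * q J.
Proof.
elim: J => [|J IH]; first by rewrite !big_geq// addr0 subrr.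
by rewrite !big_nat_recr//= IH; ring.
Qed.

(** Summation by parts: the boundary term at [J] vanishes with [q i J], and so do all later terms of
    the series. *)
Lemma utility_finite (R : realType) (m : nat) (u : 'I_m -> R -> R)
    (q : 'I_m -> nat -> R) (J : nat) :
  (forall i j, (J <= j)%N -> q i j = 0) ->
  utility u q = (\sum_(i < m) (u i 0 * q i 0%N +
    \sum_(0 <= j < J) marginal u i j * q i j.+1))%:E.
Proof.
move=> qJ; rewrite /utility -sumEFin; apply: eq_bigr => i _.
apply: lim_near_cst => //; exists J => // L /= JL.
have tail0 : \sum_(J <= j < L) u i j%:R * (q i j - q i j.+1) = 0.
  rewrite big_nat big1// => j /andP[Jj _].
  by rewrite !qJ ?subrr ?mulr0// ltnW.
rewrite sumEFin (big_cat_nat _ JL)//= tail0 addr0.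
have := abel_sum (fun j => u i j%:R) (q i) J.
by rewrite (qJ i J)// mulr0 subr0 => ->.
Qed.

Lemma below_total (R : realType) (m : nat) (u : 'I_m -> R -> R)
    (p q : 'I_m * nat) : p != q -> below u p q || below u q p.
Proof.
case: p q => [i j] [k l] pq; rewrite /below /=.
case: ltgtP => //= _; case: (ltngtP i k) => [|//|/val_inj ik]; rewrite ?orbT//.
rewrite ik !eqxx /=; case: (ltngtP j l) => //; rewrite ?orbT// => jl.
by move: pq; rewrite ik jl eqxx.
Qed.

Lemma below_irrefl (R : realType) (m : nat) (u : 'I_m -> R -> R)
    (p : 'I_m * nat) : below u p p = false.
Proof. by rewrite /below !ltxx !ltnn eqxx andbF. Qed.

Lemma below_asym (R : realType) (m : nat) (u : 'I_m -> R -> R)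
    (p q : 'I_m * nat) : below u p q -> below u q p = false.
Proof.
case: p q => [i j] [k l]; rewrite /below /=.
case: ltgtP => //= _ /orP[ki|/andP[/eqP -> lj]].
  by rewrite ltnNge ltnW// -val_eqE /= ltn_eqF.
by rewrite ltnn eqxx ltnNge ltnW.
Qed.

Section optimal_assignment.
Context (R : realType) (m : nat) (u : 'I_m -> R -> R) (alpha : 'I_m -> R).
Variables (rho c : R) (sigma : 'I_m * nat).
Hypotheses (c0 : 0 < c) (alpha_ge : forall i, c <= alpha i).
Hypothesis sigmaP : is_sigma_star u alpha rho sigma.

Let above := [set p : 'I_m * nat | (1 <= p.2)%N /\ below u sigma p].

Let alpha0 i : 0 <= alpha i. Proof. exact: le_trans (ltW c0) (alpha_ge i). Qed.

(** Otherwise more than rho / c pairs, each of mass at least [c], would lie above [sigma] and give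
    [mass_above] a value larger than [rho]. *)
Lemma finite_above : finite_set above.
Proof.
apply: contrapT => inf; have [_ + _] := sigmaP; rewrite leNgt => /negP; apply.
have [B Babove cardB] := infinite_set_fset (Num.truncn (rho / c)).+1 inf.
have Bc : (rho%:E < \sum_(p <- B) c%:E)%E.
  rewrite sumEFin lte_fin big_const_seq count_predT iter_addr_0 -mulr_natl.
  rewrite -ltr_pdivrMr// (lt_le_trans (truncnS_gt _))// ler_nat.
  exact: cardB.
have BA : (\sum_(p <- B) c%:E <= \sum_(p <- B) (alpha p.1)%:E)%E.
  by apply: lee_sum => p _; rewrite lee_fin.
apply: (lt_le_trans Bc); apply: (le_trans BA).
apply: esum_ge; exists [set` B]; first by split => //; exact: finite_fset.
by rewrite fsbig_finite//= set_fsetK.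
Qed.

(** A level past [sigma] and past the finitely many pairs above it reduces the series over levels
    for [q_star] to finite sums. *)
Lemma above_bounded : exists2 J, (sigma.2 < J)%N &
  forall i j, (J <= j)%N -> ~~ below u sigma (i, j).
Proof.
pose s := fset_set above.
exists (maxn sigma.2 (\max_(p <- s) p.2)).+1; first by rewrite ltnS leq_maxl.
move=> i j Jj; apply/negP => ij.
have ijs : (i, j) \in s.
  rewrite in_fset_set; last exact: finite_above.
  by apply/mem_set; split=> //; case: j Jj {ij}.
have jmax : (j <= \max_(p <- s) p.2)%N by rewrite (big_rem (i, j))//= leq_maxl.
move: Jj; rewrite ltnNge => /negP; apply.
by rewrite (leq_trans jmax)// leq_maxr.
Qed.

Lemma mass_aboveE (J : nat) :
  (forall i j, (J <= j)%N -> ~~ below u sigma (i, j)) ->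
  mass_above u alpha sigma = (\sum_(i < m) \sum_(0 <= j < J)
    if below u sigma (i, j.+1) then alpha i else 0)%:E.
Proof.
move=> HJ; rewrite /mass_above esum_fset; first last.
- by move=> p _; rewrite lee_fin.
- exact: finite_above.
rewrite fsbig_mkcond.
(* This rectangle contains every pair above [sigma]; its levels 1 to [J] are the [j.+1] of the
   finite sums. *)
pose r := [seq (i, j) | i <- index_enum 'I_m, j <- index_iota 1 J.+1].
rewrite (fsbigE r)//=; last first.
- move=> [i j] _ ijr; rewrite patchE; case: ifPn => // /set_mem[/= j1 ij].
  exfalso; move/negP: ijr; apply; apply/allpairsP; exists (i, j); split=> //=.
    by rewrite mem_index_enum.
  rewrite mem_index_iota j1 /= ltnS ltnW// ltnNge; apply/negP => Jj.
  by move: (HJ i j Jj); rewrite ij.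
- apply: allpairs_uniq => [||[? ?] [? ?]//]; first exact: index_enum_uniq.
  exact: iota_uniq.
under eq_bigl do rewrite in_setT.
rewrite -sumEFin /r big_allpairs; apply: eq_bigr => i _.
rewrite big_add1 /= -sumEFin; apply: eq_bigr => j _; rewrite patchE.
case: ifPn => [/set_mem[_ ->]//|].
by rewrite notin_setE /=; case: ifP => // ij [].
Qed.

Lemma q_star_support (J : nat) : (sigma.2 < J)%N ->
  (forall i j, (J <= j)%N -> ~~ below u sigma (i, j)) ->
  forall i j, (J <= j)%N -> q_star u alpha rho sigma i j = 0.
Proof.
move=> sJ HJ i j Jj; rewrite /q_star; case: eqP => [j0|_].
  by move: sJ; rewrite ltnNge (leq_trans Jj)// j0.
have : (i, j) != sigma.
  by apply/eqP => ij; move: sJ; rewrite -ij /= ltnNge Jj.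
by move=> /below_total-/(_ R u)/orP[->//|]; rewrite (negPf (HJ i j Jj)).
Qed.

(** The saturated pairs carry [mass_above], and the value at [sigma] is what they leave of [rho]. *)
Lemma sum_q_star (J : nat) : (sigma.2 < J)%N ->
  (forall i j, (J <= j)%N -> ~~ below u sigma (i, j)) ->
  \sum_(i < m) \sum_(0 <= j < J) q_star u alpha rho sigma i j.+1 = rho.
Proof.
move=> sJ HJ; set M := fine (mass_above u alpha sigma).
have [sigma1 _ _] := sigmaP.
transitivity (\sum_(i < m) (\sum_(0 <= j < J)
    (if below u sigma (i, j.+1) then alpha i else 0) +
  \sum_(0 <= j < J) if (i, j.+1) == sigma then rho - M else 0)).
  apply: eq_bigr => i _; rewrite -big_split /=; apply: eq_bigr => j _.
  rewrite /q_star /=; case: eqVneq => [->|ij].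
    by rewrite below_irrefl add0r.
  have := below_total u ij; case: ifPn => [/below_asym -> _|_ /= ->].
    by rewrite addr0.
  by rewrite addr0.
rewrite big_split /= {1}/M (mass_aboveE HJ) /=.
set s1 := \sum_(i < m) _.
rewrite [X in _ + X](_ : _ = rho - s1); first by rewrite addrC subrK.
have -> : s1 = M by rewrite /M (mass_aboveE HJ).
rewrite (bigD1 sigma.1)//= [X in _ + X]big1 ?addr0; last first.
  move=> i i_s; rewrite big1// => j _; case: eqP => // ij.
  by move: i_s; rewrite -ij eqxx.
(* Levels are shifted by one, so [sigma] is met at index [sigma.2.-1]. *)
have js : (sigma.2.-1 < J)%N by exact: leq_ltn_trans (leq_pred _) sJ.
rewrite big_mkord.
rewrite (bigD1 (Ordinal js))//= prednK// -surjective_pairing eqxx.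
rewrite big1 ?addr0// => j jne; case: eqP => // ij.
by move: jne; rewrite -val_eqE /= -[in _.-1]ij eqxx.
Qed.

(** The marginal utility at [sigma] acts as a multiplier for the constraint on the total. The total
    of [q] stays free because for the stationary occupancy only its mean is [rho]. *)
Lemma utility_le (J : nat) (q : 'I_m -> nat -> R) : (sigma.2 < J)%N ->
  (forall i j, (J <= j)%N -> ~~ below u sigma (i, j)) ->
  (forall i, q i 0%N = alpha i) -> (forall i j, 0 <= q i j <= alpha i) ->
  (forall i j, (J <= j)%N -> q i j = 0) ->
  (utility u q <= utility u (q_star u alpha rho sigma) +
    (marginal u sigma.1 sigma.2.-1 *
      (\sum_(i < m) \sum_(0 <= j < J) q i j.+1 - rho))%:E)%E.
Proof.
move=> sJ HJ q0 qb qJ; set D := marginal _ _ _.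
rewrite (utility_finite _ qJ) (utility_finite _ (q_star_support sJ HJ)).
have -> : \sum_(i < m) \sum_(0 <= j < J) q i j.+1 - rho =
    \sum_(i < m) \sum_(0 <= j < J)
      (q i j.+1 - q_star u alpha rho sigma i j.+1).
  rewrite -[X in _ - X](sum_q_star sJ HJ) -sumrB.
  by apply: eq_bigr => i _; rewrite sumrB.
rewrite -EFinD lee_fin mulr_sumr -big_split /=; apply: ler_sum => i _.
rewrite q0 -addrA lerD2l mulr_sumr -big_split /=.
apply: ler_sum => j _; have /andP[qge qle] := qb i j.+1.
rewrite /q_star /=; set M := rho - _.
(* Below [sigma] the marginal is at most [D] and [q_star] is zero; above it the marginal is at least
   [D] and [q] cannot exceed [q_star]; the remaining pair is [sigma], where equality holds. *)
have [ij|ij] := boolP (below u (i, j.+1) sigma).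
  rewrite mulr0 add0r subr0 ler_wpM2r//.
  by move: ij; rewrite /below /= => /orP[/ltW//|/andP[/eqP -> _]].
have [ji|ji] := boolP (below u sigma (i, j.+1)).
  have DL : D <= marginal u i j.
    by move: ji; rewrite /below /= => /orP[/ltW//|/andP[/eqP <- _]].
  nra.
have -> : marginal u i j = D; last by rewrite -mulrDr addrC subrK.
have := @below_total _ _ u (i, j.+1) sigma; rewrite (negPf ij) (negPf ji) /=.
by case: eqP => [ijs _|_ /(_ isT)//]; rewrite /D -ijs.
Qed.

End optimal_assignment.

(** * Comparison in expectation *)

(* [integral] is total: neither f nor g has to be measurable.  This is needed
   because [utility u (q w)] is controlled only for w in an event of
   probability one. *)
Lemma le_integral_pointwise (R : realType) d (Omega : measurableType d)
    (P : {measure set Omega -> \bar R}) (f g : Omega -> \bar R) :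
  (forall w, f w <= g w)%E -> (\int[P]_w f w <= \int[P]_w g w)%E.
Proof.
move=> fg; rewrite /integral !patch_setT.
apply: leeB; apply: le_ereal_sup => _ [h /= hle <-];
  exists h => //= w; apply: le_trans (hle w) _.
  by apply: (@funepos_le _ _ setT); rewrite ?in_setT// => x _; exact: fg.
by apply: (@funeneg_le _ _ setT); rewrite ?in_setT// => x _; exact: fg.
Qed.

(** Setting [g] to [+oo] off [G] keeps its integral and makes the inequality hold everywhere, so the
    pointwise comparison applies even if [f] fails to be measurable. *)
Lemma le_integral_ae (R : realType) d (Omega : measurableType d)
    (P : {measure set Omega -> \bar R}) (G : set Omega)
    (f g : Omega -> \bar R) :
  measurable G -> P (~` G) = 0%E -> measurable_fun setT g ->
  (forall w, G w -> f w <= g w)%E -> (\int[P]_w f w <= \int[P]_w g w)%E.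
Proof.
move=> mG PG mg fg; pose g' w := if w \in G then g w else +oo%E.
have mg' : measurable_fun setT g'.
  rewrite -(setUv G); apply/measurable_funU => //; first exact: measurableC.
  split; [apply: (@eq_measurable_fun _ _ _ _ G g)|
          apply: (@eq_measurable_fun _ _ _ _ (~` G) (cst +oo%E))] => //.
  - by move=> w Gw; rewrite /g' Gw.
  - exact: measurable_funTS.
  - by move=> w /set_mem Gw; rewrite /g' memNset.
rewrite (@ae_eq_integral _ _ _ P setT g' g)//.
  apply: le_integral_pointwise => w; rewrite /g'.
  case: ifPn => [/set_mem/fg//|_].
  exact: leey.
exists (~` G); split=> //; first exact: measurableC.
by move=> w /= /not_implyP[_ gg'] Gw; apply: gg'; rewrite /g' mem_set.
Qed.

(** * Occupancies of task configurations *)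

Section occupancy.
Context (R : realType) (m n : nat) (cls : 'I_n -> 'I_m).
Implicit Types (y : 'I_n -> nat) (i : 'I_m) (j J : nat).

Lemma occupancy0 y i : occupancy R cls y i 0 = class_fraction R cls i.
Proof.
rewrite /occupancy /class_fraction /pools_of_class.
by under eq_finset do rewrite leq0n andbT.
Qed.

Lemma occupancy_bounds y i j :
  0 <= occupancy R cls y i j <= class_fraction R cls i.
Proof.
rewrite divr_ge0//= ler_wpM2r ?invr_ge0// ler_nat subset_leq_card//.
by apply/fintype.subsetP => p; rewrite !finset.inE => /andP[].
Qed.

Lemma occupancy_eq0 y i j : (forall p, (y p < j)%N) ->
  occupancy R cls y i j = 0.
Proof.
move=> yj; rewrite /occupancy (_ : finset _ = finset.set0) ?cards0 ?mul0r//.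
by apply/finset.setP => p; rewrite !finset.inE leqNgt yj andbF.
Qed.

(** Double counting: a pool [p] contributes once at each level from 1 to [y p], in its own class
    only. *)
Lemma sum_occupancy y J : (forall p, (y p <= J)%N) ->
  \sum_(i < m) \sum_(0 <= j < J) occupancy R cls y i j.+1 =
  (\sum_(p < n) y p)%:R / n%:R.
Proof.
move=> yJ; rewrite /occupancy.
under eq_bigr do rewrite -mulr_suml -natr_sum.
rewrite -mulr_suml -natr_sum; congr (_%:R * _).
have cardE i j : #|[set p | (cls p == i) && (j < y p)%N]%SET| =
    (\sum_(p < n) (cls p == i) * (j < y p))%N.
  rewrite -sum1_card big_mkcond /=; apply: eq_bigr => p _.
  by rewrite finset.inE; case: (cls p == i); case: (j < y p)%N.
under eq_bigr => i _.
  under eq_bigr do rewrite cardE.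
  rewrite exchange_big /=.
  over.
rewrite exchange_big /=; apply: eq_bigr => p _.
rewrite (bigD1 (cls p))//= [X in (_ + X)%N]big1 ?addn0; last first.
  by move=> i; rewrite eq_sym => /negPf ->; rewrite big1.
rewrite eqxx; under eq_bigr do rewrite mul1n.
have sumlt K : (\sum_(0 <= j < K) (j < y p) = minn (y p) K)%N.
  elim: K => [|K IH]; first by rewrite big_geq// minn0.
  rewrite big_nat_recr//= IH; have [yK|Ky] := leqP (y p) K.
    by rewrite addn0 !(minn_idPl _)// leqW.
  by rewrite (minn_idPr Ky) addn1.
by rewrite sumlt (minn_idPl (yJ p)).
Qed.

(* The absolute values make the series meaningful, and measurable in x, for
   every x, not only for occupancies. *)
Definition total_occupancy (x : 'I_m -> nat -> R) : \bar R :=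
  (\sum_(i < m) \sum_(j <oo) `|x i j.+1|%:E)%E.

Lemma total_occupancyE y :
  total_occupancy (occupancy R cls y) = ((\sum_(p < n) y p)%:R / n%:R)%:E.
Proof.
pose J := (\sum_(p < n) y p)%N.
have yJ p : (y p <= J)%N by rewrite /J (bigD1 p)//= leq_addr.
rewrite -(sum_occupancy yJ) -sumEFin; apply: eq_bigr => i _.
apply: lim_near_cst => //; exists J => // L /= JL.
rewrite sumEFin (big_cat_nat _ JL)//= [X in _ + X]big1_seq ?addr0.
  congr EFin; apply: eq_bigr => j _; apply: ger0_norm.
  by have /andP[] := occupancy_bounds y i j.+1.
move=> j /andP[_]; rewrite mem_index_iota => /andP[Jj _].
rewrite occupancy_eq0 ?normr0// => p; exact: leq_ltn_trans (yJ p) _.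
Qed.

End occupancy.

(** The generators are those in [distributed_as], so the measurable sets of this type are exactly
    the sets [C] tested there. *)
Definition occupancy_space (R : realType) (m : nat) :=
  g_sigma_algebraType (\bigcup_(ij in [set: 'I_m * nat])
    preimage_set_system setT (fun x : 'I_m -> nat -> R => x ij.1 ij.2)
      measurable).

Section occupancy_space.
Context (R : realType) (m n : nat) (cls : 'I_n -> 'I_m).

Lemma measurable_coord i j :
  measurable_fun setT (fun x : occupancy_space R m => x i j).
Proof.
move=> _ B mB; apply: sub_sigma_algebra; exists (i, j) => //.
by exists B.
Qed.

Lemma measurable_fun_occupancy d (Omega : measurableType d)
    (f : Omega -> occupancy_space R m) :
  (forall i j, measurable_fun setT (fun w => f w i j)) -> measurable_fun setT f.
Proof.
move=> mf; apply: (@measurability _ _ _ _ setT f _ erefl) => //.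
move=> _ [_ [[i j] _ [B mB <-]] <-]; rewrite !setTI.
by rewrite -[X in measurable X]setTI; exact: mf.
Qed.

Lemma measurable_occupancy d (S : measurableType d) (tasks : S -> 'I_n -> nat) :
  (forall p, measurable_fun setT (fun x => tasks x p)) ->
  measurable_fun setT
    (fun x => occupancy R cls (tasks x) : occupancy_space R m).
Proof.
move=> mtasks; apply: measurable_fun_occupancy => i j.
pose g p (c : nat) : R := ((cls p == i) && (j <= c)%N)%:R.
rewrite (_ : (fun x => _) = fun x => (\sum_(p < n) g p (tasks x p)) / n%:R).
  apply: measurable_funM => //; apply: measurable_sum => p.
  by apply: (measurableT_comp (f := g p)).
apply/funext => x; rewrite /occupancy -sum1_card natr_sum big_mkcond /=.
by congr (_ / _); apply: eq_bigr => p _; rewrite finset.inE /g; case: ifP.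
Qed.

Lemma measurable_total_occupancy :
  measurable_fun setT (fun x : occupancy_space R m => total_occupancy x).
Proof.
apply: emeasurable_sum => i.
apply: measurable_nneseries => // j; apply/measurable_EFinP.
by apply: measurableT_comp => //; exact: measurable_coord.
Qed.

(** The configurations, taken as finite functions, form a countable type, and each occupancy is a
    point cut out by countably many coordinates. *)
Lemma measurable_range_occupancy :
  measurable (range (occupancy R cls) : set (occupancy_space R m)).
Proof.
rewrite (_ : range _ = \bigcup_(y in [set: {ffun 'I_n -> nat}])
    \bigcap_(ij in [set: 'I_m * nat])
      [set x : occupancy_space R m | x ij.1 ij.2 = occupancy R cls y ij.1 ij.2]).
  apply: countable_bigcupT_measurable => [|y]; first exact: countableP.
  rewrite -[X in measurable X]setCK setC_bigcap; apply: measurableC.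
  apply: countable_bigcupT_measurable => [|[i j]]; first exact: countableP.
  apply: measurableC; rewrite -[X in measurable X]setTI.
  exact: (@measurable_coord i j measurableT [set occupancy R cls y i j]).
apply/seteqP; split=> x.
  move=> [y _ <-]; exists [ffun p => y p] => // ij _ /=.
  by congr (occupancy R cls _ _ _); apply/funext => p; rewrite ffunE.
move=> [y _ xy]; exists y => //; apply/funext => i; apply/funext => j.
by rewrite (xy (i, j) I).
Qed.

End occupancy_space.

(** * Expected utility of the stationary occupancy *)

Theorem theorem1 (R : realType) (m n : nat) (m_ge1 : (1 <= m)%N)
    (u : 'I_m -> R -> R) (u_concave : forall i, concave_on_nonneg (u i))
    (cls : 'I_n -> 'I_m) (cls_ge1 : forall i, (1 <= pools_of_class cls i)%N)
    (lambda mu : R) (lambda_gt0 : 0 < lambda) (mu_gt0 : 0 < mu)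
    (dO : measure_display) (Omega : measurableType dO) (P : probability Omega R)
    (T V : nat -> Omega -> R)
    (arrivals : poisson_process P (n%:R * lambda) T)
    (services : iid_service_times P mu T V)
    (a : nat -> Omega -> 'I_n) (res : 'I_n -> nat -> Omega -> R)
    (dS : measure_display) (S : measurableType dS) (tasks : S -> 'I_n -> nat)
    (X : R -> Omega -> S) (evolution : system_evolution tasks T V a res X)
    (K : R -> R.-pker S ~> S) (X_markov : markov_process P K X)
    (pi : probability S R) (pi_stationary : stationary_distribution K pi)
    (X0_pi : forall B, measurable B -> P (X 0 @^-1` B) = pi B)
    (dO' : measure_display) (Omega' : measurableType dO')
    (P' : probability Omega' R) (q : Omega' -> 'I_m -> nat -> R)
    (q_law : distributed_as P' q pi (fun x => occupancy R cls (tasks x)))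
    (sigma : 'I_m * nat)
    (sigmaP : is_sigma_star u (class_fraction R cls) (lambda / mu) sigma) :
  (\int[P']_w utility u (q w)
     <= utility u (q_star u (class_fraction R cls) (lambda / mu) sigma))%E.
Proof.
have n0 : (0 < n)%N.
  have := cls_ge1 (Ordinal m_ge1); rewrite /pools_of_class card_gt0.
  by move=> /set0Pn[p _]; exact: leq_ltn_trans (ltn_ord p).
have nR0 : 0 < n%:R :> R by rewrite ltr0n.
have meanN := stationary_mean (mulr_gt0 nR0 lambda_gt0) arrivals services
  evolution X_markov pi_stationary X0_pi.
(* Every class has a pool, so [n%:R^-1] serves as the uniform lower bound [c] on the class
   fractions. *)
have alpha_ge i : n%:R^-1 <= class_fraction R cls i.
  by rewrite -[leLHS]mul1r ler_wpM2r ?invr_ge0// ler1n.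
have nV0 : 0 < n%:R^-1 :> R by rewrite invr_gt0.
set rho := lambda / mu; set alpha := class_fraction R cls.
pose D := marginal u sigma.1 sigma.2.-1.
have [J sJ HJ] := above_bounded nV0 alpha_ge sigmaP.
have [Ustar UE] : exists x : R, utility u (q_star u alpha rho sigma) = x%:E.
  by eexists; apply: utility_finite; exact: q_star_support sJ HJ.
have mtasks p : measurable_fun setT (fun x => tasks x p) by case: evolution.
pose Q : Omega' -> occupancy_space R m := q.
pose occ : S -> occupancy_space R m := fun x => occupancy R cls (tasks x).
have mQ : measurable_fun setT Q.
  by move=> _ C mC; rewrite setTI; case: (q_law _ mC).
have mocc : measurable_fun setT occ by exact: measurable_occupancy.
have mtot := @measurable_total_occupancy R m.
have tot0 x : (0 <= total_occupancy (x : 'I_m -> nat -> R))%E.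
  by apply: sume_ge0 => i _; apply: nneseries_ge0.
have mean_tot : (\int[P']_w total_occupancy (q w) = rho%:E)%E.
  rewrite (@ge0_integral_eq_law _ _ _ _ _ _ _ P' pi Q occ
    (@total_occupancy R m))//; last first.
    by move=> C mC; case: (q_law _ mC).
  rewrite (eq_integral (fun x =>
      (n%:R^-1)%:E * (\sum_(p < n) tasks x p)%:R%:E)%E); last first.
    by move=> x _; rewrite total_occupancyE mulrC EFinM.
  rewrite ge0_integralZl_EFin ?ltW//; last first.
    apply/measurable_EFinP.
    apply: (@measurableT_comp _ _ _ _ _ _ (fun c : nat => c%:R : R)) => //.
    exact: measurable_fun_sumn.
  rewrite meanN -EFinM /rho; congr EFin; field.
  by rewrite !gt_eqF.
have mtotQ : measurable_fun setT (fun w => total_occupancy (q w)).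
  exact: (measurableT_comp mtot mQ).
have itot : P'.-integrable setT (fun w => total_occupancy (q w)).
  apply/integrableP; split=> //.
  under eq_integral do rewrite gee0_abs//.
  by rewrite mean_tot ltry.
have iD : P'.-integrable setT (fun w => D%:E * total_occupancy (q w))%E.
  exact: integrableZl.
(* The law of [q] makes it an occupancy only almost surely; the deterministic bound is applied on
   this event. *)
pose G := q @^-1` range (occupancy R cls).
have [mG PGpi] := q_law _ (@measurable_range_occupancy R m n cls).
have PG0 : P' (~` G) = 0%E.
  rewrite probability_setC// PGpi (_ : _ @^-1` _ = setT).
    by rewrite probability_setT subee.
  by apply/seteqP; split=> // x _; exists (tasks x).
apply: (@le_trans _ _
  (\int[P']_w ((Ustar - D * rho)%:E + D%:E * total_occupancy (q w)))%E).
  apply: (le_integral_ae mG PG0).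
  - by apply: emeasurable_funD => //; exact: emeasurable_funM.
  move=> w [y _ qy]; rewrite -qy total_occupancyE.
  (* The truncation level depends on the outcome: it must also exceed the number of tasks at every
     pool. *)
  pose J' := maxn J (\sum_(p < n) y p).+1.
  have yJ p : (y p <= \sum_(p < n) y p)%N by rewrite (bigD1 p)//= leq_addr.
  have JJ' : (J <= J')%N by rewrite leq_maxl.
  apply: (@le_trans _ _ _ _ _
    (utility_le nV0 alpha_ge sigmaP (J := J') _ _ _ _ _)).
  - exact: leq_trans sJ JJ'.
  - by move=> i j Jj; apply: HJ; exact: leq_trans JJ' Jj.
  - by move=> i; exact: occupancy0.
  - by move=> i j; exact: occupancy_bounds.
  - move=> i j Jj; apply: occupancy_eq0 => p.
    by apply: leq_ltn_trans (yJ p) _; apply: leq_trans Jj; rewrite leq_maxr.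
  rewrite UE sum_occupancy; last first.
    by move=> p; rewrite (leq_trans (yJ p))// ltnW// leq_maxr.
  by rewrite -EFinM -!EFinD lee_fin -/D mulrBr -/rho; lra.
(* The mean total is exactly [rho], so the terms in [D] cancel whatever its sign. *)
rewrite integralD//; last exact: finite_measure_integrable_cst.
rewrite integralZl// mean_tot UE (_ : \int[P']_w _ = (Ustar - D * rho)%:E)%E.
  by rewrite -EFinM -EFinD lee_fin subrK.
rewrite integral_cst// -[RHS]mule1; congr *%E; exact: probability_setT.
Qed.
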